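(* Let $\Psi=\{A_1,\dots,A_m\}\subset\mathbb{R}_+^{n\times n}$ be a finite set of nonnegative matrices with $A_i\neq 0$ for at least one $i$. Then: (i) $\hat\mu(\Psi)=\min_{x\in\operatorname{int}(\mathbb{R}_+^n)}\left(\max_{1\le i\le m}e_{A_i}(x)\right)$; (ii) $x$ solves the optimisation problem $\min_{x\in\operatorname{int}(\mathbb{R}^n_+)}\left(\max_{1\le i\le m}e_{A_i}(x)\right)$ if and only if $x\in\mathcal{C}_\Psi$.
   Context: $\mathbb{R}_+$ is the set of nonnegative reals and $\operatorname{int}(\mathbb{R}^n_+)$ is the set of $n$-tuples of positive reals. For $A\in\mathbb{R}_+^{n\times n}$ and $x\in\operatorname{int}(\mathbb{R}^n_+)$, $e_A(x)=\max_{1\le i,j\le n}a_{ij}x_j/x_i$. Max-algebraic product: $(A\otimes B)_{ij}=\max_k a_{ik}b_{kj}$. $\mu(A)$ is the maximal cycle geometric mean: the maximum of $(a_{i_1i_2}a_{i_2i_3}\cdots a_{i_ki_1})^{1/k}$ over all $k\ge 1$ and all sequences of distinct indices $i_1,\dots,i_k$. For $p\ge1$, $\Psi_\otimes^p=\{A_{j_1}\otimes\cdots\otimes A_{j_p}: 1\le j_k\le m \text{ for } 1\le k\le p\}$. The (max version of the) generalised spectral radius is $\hat\mu(\Psi)=\limsup_{p\to\infty}\left(\max_{\psi\in\Psi_\otimes^p}\mu(\psi)\right)^{1/p}$. For real $r$, $\mathcal{C}_{\Psi,r}=\{x\in\operatorname{int}(\mathbb{R}^n_+)\mid e_{A_i}(x)\le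 r \text{ for all } i=1,\dots,m\}$, and $\mathcal{C}_\Psi=\mathcal{C}_{\Psi,\hat\mu(\Psi)}$.
   Formalization: In (i) the minimum is claimed attained only when μ̂(Ψ)>0; in general μ̂(Ψ) is shown to be the infimum. For Ψ={A}, A with rows (0,1),(0,0), μ̂(Ψ)=0 but e_A(x)=x_2/x_1>0 for all positive x, so no minimum exists. *)

(* Defs.v *)
From HB Require Import structures.
From mathcomp Require Import all_boot all_order all_algebra.
From mathcomp Require Import all_classical all_reals all_analysis.

Set Implicit Arguments.
Unset Strict Implicit.
Unset Printing Implicit Defensive.

Import Order.TTheory GRing.Theory Num.Theory.
Import numFieldNormedType.Exports.

Local Open Scope classical_set_scope.
Local Open Scope ring_scope.

(* All the iterated maxima below are maxima of nonnegative reals when the     *)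
(* matrices are nonnegative and the vectors positive, so starting them at 0   *)
(* does not change their value (over a nonempty index set).                   *)

Section MaxAlgebra.
Variables (R : realType) (n : nat).
Implicit Types (A B : 'M[R]_n) (x : 'rV[R]_n).

Definition nonneg_mx A := forall i j, 0 <= A i j.

Definition int_orthant : set 'rV[R]_n := [set x | forall i, 0 < x 0 i].

Definition max_err A x : R :=
  \big[Num.max/0]_(i < n) \big[Num.max/0]_(j < n) (A i j * x 0 j / x 0 i).

Definition max_mulmx A B : 'M[R]_n :=
  \matrix_(i, j) \big[Num.max/0]_(k < n) (A i k * B k j).

(* (a_{s_0 s_1} a_{s_1 s_2} ... a_{s_k s_0})^{1/(k+1)}; [ordS] is the cyclic  *)
(* successor on 'I_k.+1.                                                      *)
Definition cycle_gmean A k (s : k.+1.-tuple 'I_n) : R :=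
  (\prod_(l < k.+1) A (tnth s l) (tnth s (ordS l))) `^ (k.+1%:R^-1).

(* A sequence of distinct elements of 'I_n has length k.+1 <= n, so k < n     *)
(* exhausts all lengths.                                                      *)
Definition max_cycle_gmean A : R :=
  \big[Num.max/0]_(k < n)
    \big[Num.max/0]_(s : k.+1.-tuple 'I_n | uniq s) cycle_gmean A s.

End MaxAlgebra.

Section FamilyOfMatrices.
Variables (R : realType) (n m : nat).
Implicit Types (Psi : 'I_m -> 'M[R]_n) (x : 'rV[R]_n).

(* 1%:M is also the unit of [max_mulmx] on nonnegative matrices.              *)
Definition max_prod Psi p (j : p.-tuple 'I_m) : 'M[R]_n :=
  \big[@max_mulmx R n/1%:M]_(k <- j) Psi k.

(* The term of index p = 0 is irrelevant to the limit superior.               *)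
Definition gen_spectral_radius Psi : R :=
  limn_sup (fun p : nat =>
    (\big[Num.max/0]_(j : p.-tuple 'I_m) max_cycle_gmean (max_prod Psi j))
      `^ (p%:R^-1)).

Definition max_err_family Psi x : R :=
  \big[Num.max/0]_(i < m) max_err (Psi i) x.

Definition C_set_at Psi (r : R) : set 'rV[R]_n :=
  [set x | int_orthant x /\ forall i, max_err (Psi i) x <= r].

Definition C_set Psi : set 'rV[R]_n := C_set_at Psi (gen_spectral_radius Psi).

End FamilyOfMatrices.

Definition is_minimizer (R : realType) (T : Type) (D : set T) (f : T -> R)
    (x : T) : Prop :=
  D x /\ forall y, D y -> f x <= f y.

(* Main.v *)
(* For a nonnegative family, max_i e_{A_i}(x) <= e says that A_i (x) x <= e x   *)
(* entrywise for every i, hence psi (x) x <= e^p x for every product psi of    *)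
(* length p; telescoping around cycles bounds the spectral radius rho by e.    *)
(* Conversely, every closed walk of length k in the entrywise maximum S of the *)
(* family has weight at most rho^k, since its repetitions appear on the        *)
(* diagonals of products. So for every positive r >= rho all cycles of S / r   *)
(* have weight at most 1, and the maximal weights of simple paths form a       *)
(* positive vector x with S (x) x <= r x, that is max_i e_{A_i}(x) <= r.        *)

Require Import Defs.
From HB Require Import structures.
From mathcomp Require Import all_boot all_order all_algebra.
From mathcomp Require Import all_classical all_reals all_analysis.

Set Implicit Arguments.
Unset Strict Implicit.
Unset Printing Implicit Defensive.

Import Order.TTheory GRing.Theory Num.Theory.
Import numFieldNormedType.Exports.

Local Open Scope classical_set_scope.
Local Open Scope ring_scope.

(** Write rho for the spectral radius. Any positive x certifies rho <= max_i e_{A_i}(x), by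
    [gen_spectral_radius_le]. In the other direction, [closed_walk_le] bounds closed walks by powers
    of rho, and [exists_subeigenvector] converts such cycle bounds into a positive vector;
    [exists_max_err_family_le] thus reaches every level r >= rho with r > 0. Taking r = rho + d
    shows that rho is the infimum, and r = rho attains it when rho > 0. A minimiser is then exactly
    a positive x whose error is at most rho, which is membership in [C_set]. *)

(** * Bounds on limits superior of bounded sequences *)

Section LimitSuperior.
Variables (R : realType) (u : R^nat) (M : R).
Hypothesis u_bounded : forall p, `|u p| <= M.

Let bnd_u : bounded_fun (u : (R^o)^nat).
Proof.
exists M; split; first exact: num_real.
by move=> K MK p _; exact: le_trans (u_bounded p) (ltW MK).
Qed.

Lemma limn_sup_le e N : (forall p, (N <= p)%N -> u p <= e) -> limn_sup u <= e.
Proof.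
move=> ue; rewrite limn_supE//; apply: (@le_trans _ _ (sups u N)).
  by apply: ge_inf; [exact: bounded_fun_has_lbound_sups|exists N].
apply: ge_sup; first by exists (u N); exists N => /=.
by move=> _ [p /= Np <-]; exact: ue.
Qed.

Lemma limn_sup_ge c :
  (forall N, exists2 p, (N <= p)%N & c <= u p) -> c <= limn_sup u.
Proof.
move=> uc; rewrite limn_supE//; apply: lb_le_inf; first by exists (sups u 0%N), 0%N.
move=> _ [N _ <-]; have [p Np cp] := uc N; apply: (le_trans cp).
apply: ub_le_sup; last by exists p.
by exists M => _ [q _ <-]; exact: le_trans (ler_norm _) (u_bounded q).
Qed.

End LimitSuperior.

(** * A single matrix: cycle means, walks and subeigenvectors *)

Section MaxAlgebraTheory.
Variables (R : realType) (n : nat).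
Implicit Types (A B : 'M[R]_n) (x : 'rV[R]_n) (i j : 'I_n) (s t : seq 'I_n).

Lemma max_err_leP A x e : int_orthant x -> 0 <= e ->
  reflect (forall i j, A i j * x 0 j <= e * x 0 i) (max_err A x <= e).
Proof.
move=> x_gt0 e0; apply: (iffP idP) => [/bigmax_leP[_ H] i j|H].
  have /bigmax_leP[_ /(_ j isT)] := H i isT.
  by rewrite ler_pdivrMr.
by apply: bigmax_le => // i _; apply: bigmax_le => // j _; rewrite ler_pdivrMr.
Qed.

Lemma max_mulmx_ge0 A B : nonneg_mx (max_mulmx A B).
Proof. by move=> i j; rewrite mxE; exact: bigmax_ge_id. Qed.

Lemma max_mulmx_ge A B i j k : A i k * B k j <= max_mulmx A B i j.
Proof. by rewrite mxE; exact: (le_bigmax _ (fun k => A i k * B k j)). Qed.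

Lemma max_mulmx_subinvariant A B x a b : nonneg_mx A -> 0 <= b ->
    int_orthant x -> 0 <= a ->
    (forall i j, A i j * x 0 j <= a * x 0 i) ->
    (forall i j, B i j * x 0 j <= b * x 0 i) ->
  forall i j, max_mulmx A B i j * x 0 j <= a * b * x 0 i.
Proof.
move=> A0 b0 x_gt0 a0 Aa Bb i j; rewrite mxE -ler_pdivlMr//.
apply: bigmax_le => [|k _].
  by rewrite divr_ge0 ?mulr_ge0// ltW.
rewrite ler_pdivlMr// -!mulrA; apply: le_trans (ler_wpM2l (A0 i k) (Bb k j)) _.
by rewrite mulrCA [leRHS]mulrCA ler_wpM2l.
Qed.

Lemma diag_le_max_cycle_gmean A i : 0 <= A i i -> A i i <= max_cycle_gmean A.
Proof.
move=> Aii; have n_gt0 : (0 < n)%N by case: n i {A Aii} => [[]|].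
apply: le_trans (le_bigmax _ _ (Ordinal n_gt0)).
apply: le_trans (@le_bigmax_cond _ _ _ 0 [tuple i] _ (@cycle_gmean R n A 0) _) => //.
by rewrite /cycle_gmean big_ord1 !(tnth_nth i)/= invr1 powRr1.
Qed.

(** Multiply the inequalities along the edges of the cycle: [ordS] permutes the positions, so the
    entries of x on both sides have the same positive product and cancel. *)
Lemma max_cycle_gmean_le A x e : nonneg_mx A -> int_orthant x -> 0 <= e ->
  (forall i j, A i j * x 0 j <= e * x 0 i) -> max_cycle_gmean A <= e.
Proof.
move=> A0 x_gt0 e0 Ae; apply: bigmax_le => // k _; apply: bigmax_le => // s _.
rewrite /cycle_gmean.
have prod_le : \prod_(l < k.+1) A (tnth s l) (tnth s (ordS l)) <= e ^+ k.+1.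
  have X_gt0 : 0 < \prod_(l < k.+1) x 0 (tnth s l) by apply: prodr_gt0.
  have -> : e ^+ k.+1 = \prod_(l < k.+1) e by rewrite prodr_const card_ord.
  rewrite -(ler_pM2r X_gt0) [X in _ * X <= _](reindex_inj (@ordS_inj _)).
  rewrite -!big_split/=.
  by apply: ler_prod => l _; rewrite Ae mulr_ge0// ltW.
apply: (le_trans (ge0_ler_powR _ _ _ prod_le)).
- by rewrite invr_ge0.
- by rewrite nnegrE prodr_ge0.
- by rewrite nnegrE exprn_ge0.
by rewrite -powR_mulrn// -powRrM divff ?pnatr_eq0// powRr1.
Qed.

Fixpoint walk_weight A i s : R :=
  if s is j :: s' then A i j * walk_weight A j s' else 1.

Lemma walk_weight_ge0 A i s : nonneg_mx A -> 0 <= walk_weight A i s.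
Proof. by move=> A0; elim: s i => //= j s IHs i; rewrite mulr_ge0. Qed.

Lemma walk_weight_cat A i s t :
  walk_weight A i (s ++ t) = walk_weight A i s * walk_weight A (last i s) t.
Proof. by elim: s i => [|j s IHs] i /=; rewrite ?mul1r// IHs mulrA. Qed.

Lemma walk_weightZ A a i s :
  walk_weight (a *: A) i s = a ^+ size s * walk_weight A i s.
Proof.
by elim: s i => [|j s IHs] i /=; rewrite ?mul1r// mxE IHs exprS mulrACA.
Qed.

Lemma walk_weight_iter A i s q : last i s = i ->
  walk_weight A i (flatten (nseq q s)) = walk_weight A i s ^+ q /\
  last i (flatten (nseq q s)) = i.
Proof.
move=> si; elim: q => [//|q [IHw IHl]] /=.
by rewrite walk_weight_cat last_cat si IHw IHl exprS.
Qed.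

(* The witness x_i is the greatest weight of a simple path from i. Prefixing  *)
(* an edge (i, j) to a simple path from j either gives a simple path from i   *)
(* or closes a cycle, and that cycle can be dropped without losing weight.    *)
Lemma exists_subeigenvector A : nonneg_mx A ->
    (forall i s, last i s = i -> walk_weight A i s <= 1) ->
  exists2 x, int_orthant x & forall i j, A i j * x 0 j <= x 0 i.
Proof.
move=> A0 cyc_le1.
(* Bounding the length by n makes the index type finite and loses no simple path. *)
pose v i := \big[Num.max/0]_(s : n.-bseq 'I_n | uniq (i :: s)) walk_weight A i s.
have v_ge i s : uniq (i :: s) -> walk_weight A i s <= v i.
  move=> s_uniq; have s_size : (size s <= n)%N.
    have := max_card (mem (i :: s)).
    by rewrite (card_uniqP s_uniq) card_ord => /ltnW.
  exact: (@le_bigmax_cond _ _ _ 0 (Bseq s_size)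
    (fun s : n.-bseq 'I_n => uniq (i :: s))
    (fun s : n.-bseq 'I_n => walk_weight A i s)).
have v_gt0 i : 0 < v i by apply: lt_le_trans (v_ge i [::] isT).
exists (\row_i v i) => [i|i j]; first by rewrite mxE.
rewrite !mxE.
have [Aij0|Aij0] := eqVneq (A i j) 0; first by rewrite Aij0 mul0r ltW.
have Aij_gt0 : 0 < A i j by rewrite lt_def Aij0 A0.
rewrite mulrC -ler_pdivlMr//; apply: bigmax_le => [|s s_uniq].
  by rewrite divr_ge0// ltW.
rewrite ler_pdivlMr// mulrC -[leLHS]/(walk_weight A i (j :: s)).
have [i_in|i_notin] := boolP (i \in j :: s); last first.
  by apply: v_ge; rewrite cons_uniq i_notin.
move: s_uniq; case: (splitPr i_in) => p1 p2.
rewrite cat_uniq => /and3P[_ _ p2_uniq].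
rewrite -cat_rcons walk_weight_cat last_rcons.
apply: le_trans (v_ge _ _ p2_uniq).
by rewrite ler_piMl ?walk_weight_ge0// cyc_le1// last_rcons.
Qed.

End MaxAlgebraTheory.

(** * Families: the spectral radius against walks in the entrywise maximum *)

Section Family.
Variables (R : realType) (n m : nat) (Psi : 'I_m -> 'M[R]_n).
Hypothesis Psi_ge0 : forall k, nonneg_mx (Psi k).
Implicit Types (x : 'rV[R]_n) (i j : 'I_n) (w : seq 'I_m).

Definition max_family : 'M[R]_n :=
  \matrix_(i, j) \big[Num.max/0]_(k < m) Psi k i j.

Lemma max_family_ge0 : nonneg_mx max_family.
Proof. by move=> i j; rewrite mxE; exact: bigmax_ge_id. Qed.

Lemma max_family_ge k i j : Psi k i j <= max_family i j.
Proof. by rewrite mxE; exact: (le_bigmax _ (fun k => Psi k i j)). Qed.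

Lemma max_family_eq i j : (0 < m)%N -> exists k, max_family i j = Psi k i j.
Proof.
move=> m_gt0; rewrite mxE (@bigmax_eq_arg _ _ _ _ (Ordinal m_gt0))//; first by eexists.
by move=> k _; exact: Psi_ge0.
Qed.

Lemma max_err_family_ge0 x : 0 <= max_err_family Psi x.
Proof. exact: bigmax_ge_id. Qed.

Lemma max_err_family_leP x e : 0 <= e ->
  reflect (forall k, max_err (Psi k) x <= e) (max_err_family Psi x <= e).
Proof.
move=> e0; apply: (iffP idP) => [/bigmax_leP[_ H] k|H]; first exact: H.
exact: bigmax_le.
Qed.

(** This is [max_prod] on plain lists, which permits induction on the word. *)
Definition word_mx w : 'M[R]_n := \big[@max_mulmx R n/1%:M]_(k <- w) Psi k.

Lemma word_mx_ge0 w : nonneg_mx (word_mx w).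
Proof.
case: w => [|k w]; rewrite /word_mx; last by rewrite big_cons; exact: max_mulmx_ge0.
by move=> i j; rewrite big_nil mxE ler0n.
Qed.

Lemma word_mx_subinvariant w x e : int_orthant x -> 0 <= e ->
    (forall k i j, Psi k i j * x 0 j <= e * x 0 i) ->
  forall i j, word_mx w i j * x 0 j <= e ^+ size w * x 0 i.
Proof.
move=> x_gt0 e0 Psi_e; rewrite /word_mx; elim: w => [|k w IHw] i j.
  rewrite big_nil mxE mul1r; have [->|_] := eqVneq i j; rewrite ?mul1r// mul0r.
  exact: ltW.
rewrite big_cons /= exprS.
by apply: max_mulmx_subinvariant => //; rewrite exprn_ge0.
Qed.

(** Each edge weight of [max_family] is attained by some member of the family; these choices, made
    edge by edge, spell the word. *)
Lemma exists_word_ge_walk i s : (0 < m)%N ->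
  exists2 w, size w = size s &
    walk_weight max_family i s <= word_mx w i (last i s).
Proof.
move=> m_gt0; elim: s i => [|j s IHs] i /=.
  by exists [::] => //; rewrite /word_mx big_nil mxE eqxx.
have [w <- w_ge] := IHs j; have [k ->] := max_family_eq i j m_gt0.
exists (k :: w) => //; rewrite /word_mx big_cons.
apply: le_trans (max_mulmx_ge _ _ _ _ j).
by rewrite ler_wpM2l// Psi_ge0.
Qed.

Let radius_seq (p : nat) : R :=
  (\big[Num.max/0]_(w : p.-tuple 'I_m) max_cycle_gmean (max_prod Psi w))
    `^ (p%:R^-1).

Lemma radius_seq_le x p : int_orthant x -> (0 < p)%N ->
  radius_seq p <= max_err_family Psi x.
Proof.
move=> x_gt0 p_gt0; set e := max_err_family _ _.
have e0 : 0 <= e := max_err_family_ge0 x.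
have Psi_e k i j : Psi k i j * x 0 j <= e * x 0 i.
  by have /max_err_family_leP/(_ k)/max_err_leP := lexx e; apply.
have -> : e = (e ^+ p) `^ p%:R^-1.
  by rewrite -powR_mulrn// -powRrM divff ?powRr1// pnatr_eq0 -lt0n.
apply: ge0_ler_powR; rewrite ?invr_ge0 ?nnegrE ?exprn_ge0 ?bigmax_ge_id//.
apply: bigmax_le => [|w _]; first exact: exprn_ge0.
apply: (max_cycle_gmean_le (x := x)) => //; first exact: word_mx_ge0.
  exact: exprn_ge0.
by move=> i j; rewrite -[in e ^+ _](size_tuple w); exact: word_mx_subinvariant.
Qed.

Lemma radius_seq_bounded p :
  `|radius_seq p| <= 1 + max_err_family Psi (const_mx 1).
Proof.
rewrite ger0_norm ?powR_ge0//; case: p => [|p].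
  (* At p = 0 the exponent is 0 and the term equals 1, hence the summand 1 in the bound. *)
  by rewrite /radius_seq invr0 powRr0 lerDl max_err_family_ge0.
rewrite (le_trans (@radius_seq_le (const_mx 1) _ _ _)) ?lerDr// => i.
by rewrite mxE.
Qed.

Lemma gen_spectral_radius_le x : int_orthant x ->
  gen_spectral_radius Psi <= max_err_family Psi x.
Proof.
move=> x_gt0; apply: (limn_sup_le radius_seq_bounded (N := 1)) => p.
exact: radius_seq_le.
Qed.

Lemma gen_spectral_radius_ge0 : 0 <= gen_spectral_radius Psi.
Proof.
apply: (limn_sup_ge radius_seq_bounded) => N; exists N => //; exact: powR_ge0.
Qed.

(* The q-fold repetition of the closed walk is read off from the diagonal of  *)
(* a product of length q * size s, so the terms of the limit superior whose   *)
(* index is a multiple of size s are all at least (weight)^(1 / size s).      *)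
Lemma closed_walk_le i s : (0 < m)%N -> last i s = i ->
  walk_weight max_family i s <= gen_spectral_radius Psi ^+ size s.
Proof.
move=> m_gt0 si; have [->//|s_neq0] := eqVneq s [::].
have s_gt0 : (0 < size s)%N by rewrite lt0n size_eq0.
set W := walk_weight _ _ _; set k := size s in s_gt0 *.
have W0 : 0 <= W by apply: walk_weight_ge0; exact: max_family_ge0.
have k_neq0 : k%:R != 0 :> R by rewrite pnatr_eq0 -lt0n.
suff root_le : W `^ k%:R^-1 <= gen_spectral_radius Psi.
  rewrite -(powRr1 W0) -(mulVf k_neq0) powRrM powR_mulrn ?powR_ge0//.
  by rewrite lerXn2r ?nnegrE ?powR_ge0 ?gen_spectral_radius_ge0.
apply: (limn_sup_ge radius_seq_bounded) => N.
(* [N.+1] repetitions keep the index positive even for N = 0. *)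
exists (N.+1 * k)%N; first by rewrite (leq_trans (leqnSn N))// leq_pmulr.
have [Wq lastq] := walk_weight_iter max_family N.+1 si.
have [w sz_w] := exists_word_ge_walk i (flatten (nseq N.+1 s)) m_gt0.
rewrite Wq lastq => w_ge.
have {}sz_w : size w == (N.+1 * k)%N.
  by rewrite sz_w size_flatten /shape map_nseq sumn_nseq mulnC.
have -> : W `^ k%:R^-1 = (W ^+ N.+1) `^ (N.+1 * k)%:R^-1.
  by rewrite -powR_mulrn// -powRrM natrM invfM mulrA divff ?mul1r// pnatr_eq0.
apply: ge0_ler_powR; rewrite ?invr_ge0 ?nnegrE ?exprn_ge0 ?bigmax_ge_id//.
apply: le_trans (le_bigmax _ _ (Tuple sz_w)).
apply: (le_trans w_ge); apply: diag_le_max_cycle_gmean; exact: word_mx_ge0.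
Qed.

(** The level r is kept apart from the spectral radius because the scaling by 1/r needs r > 0, while
    the radius may vanish. *)
Lemma exists_max_err_family_le r : (0 < m)%N -> 0 < r ->
    gen_spectral_radius Psi <= r ->
  exists2 x, int_orthant x & max_err_family Psi x <= r.
Proof.
move=> m_gt0 r_gt0 rho_le; have S0 := max_family_ge0.
have [|i s si|x x_gt0 Sx] := @exists_subeigenvector R n (r^-1 *: max_family).
- by move=> i j; rewrite mxE mulr_ge0// invr_ge0 ltW.
- rewrite walk_weightZ exprVn mulrC ler_pdivrMr ?exprn_gt0// mul1r.
  apply: le_trans (closed_walk_le m_gt0 si) _.
  by rewrite lerXn2r// nnegrE ?gen_spectral_radius_ge0// ltW.
exists x => //; apply/max_err_family_leP => [|k]; first exact: ltW.
apply/max_err_leP => // [|i j]; first exact: ltW.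
rewrite -ler_pdivrMl// mulrA; apply: le_trans (Sx i j).
by rewrite mxE ler_wpM2r ?ler_wpM2l ?max_family_ge// ?invr_ge0 ltW.
Qed.

End Family.

(* If gen_spectral_radius Psi = 0 although some Psi i != 0 (for instance for  *)
(* the single matrix with rows (0, 1) and (0, 0)), the minimum is an infimum  *)
(* that is not attained; it is attained in all other cases.                   *)
Theorem proposition4p1 (R : realType) (n m : nat) (Psi : 'I_m -> 'M[R]_n)
    (Psi_ge0 : forall i, nonneg_mx (Psi i))
    (Psi_neq0 : exists i, Psi i != 0) :
  [/\ gen_spectral_radius Psi =
        inf [set max_err_family Psi x | x in @int_orthant R n],
      0 < gen_spectral_radius Psi ->
        exists2 x, is_minimizer (@int_orthant R n) (max_err_family Psi) x
                 & gen_spectral_radius Psi = max_err_family Psi x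
    & forall x : 'rV[R]_n,
        is_minimizer (@int_orthant R n) (max_err_family Psi) x
        <-> C_set Psi x].
Proof.
have m_gt0 : (0 < m)%N by case: Psi_neq0 => k _; exact: leq_ltn_trans (ltn_ord k).
set rho := gen_spectral_radius Psi.
set E := [set max_err_family Psi x | x in @int_orthant R n].
have rho0 : 0 <= rho by exact: gen_spectral_radius_ge0.
have rho_lb : lbound E rho by move=> _ [x x_gt0 <-]; exact: gen_spectral_radius_le.
have one_gt0 : @int_orthant R n (const_mx 1) by move=> i; rewrite mxE.
have E_neq0 : E !=set0 by exists (max_err_family Psi (const_mx 1)), (const_mx 1).
have rhoE : rho = inf E.
  apply/le_anti/andP; split; first exact: lb_le_inf.
  apply/ler_addgt0Pr => d d_gt0.
  have [x x_gt0 x_le] : exists2 x, int_orthant x & max_err_family Psi x <= rho + d.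
    by apply: exists_max_err_family_le => //; rewrite ?ltr_wpDl// lerDl ltW.
  by apply: le_trans x_le; apply: ge_inf; [exists rho|exists x].
split=> // [rho_gt0|x].
  have [x x_gt0 x_le] := exists_max_err_family_le Psi_ge0 m_gt0 rho_gt0 (lexx _).
  exists x; last by apply: le_anti; rewrite x_le gen_spectral_radius_le.
  by split=> // y y_gt0; apply: le_trans x_le _; exact: gen_spectral_radius_le.
split=> -[x_gt0 x_min]; split=> //.
  (* The value at a minimiser is a lower bound of [E], hence at most its infimum rho. *)
  apply/max_err_family_leP => //; rewrite -/rho rhoE.
  by apply: lb_le_inf => // _ [y y_gt0 <-]; exact: x_min.
move=> y y_gt0; apply: le_trans (gen_spectral_radius_le Psi_ge0 y_gt0).
exact/max_err_family_leP.
Qed.
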